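(* For any $\sigma>0$, $K>0$ and $d\ge1$, as $n\to\infty$, $$\mathcal{R}^\star\big(n,\sigma,\mathcal{F}^{(\mathsf{SG})}_{d,K}\big)=\Omega\left(\frac1{\sqrt n}\right).$$
   Context: A distribution $P$ on $\mathbb{R}^d$ is $K$-subgaussian ($K>0$) if $X\sim P$ satisfies $\mathbb{E}\big[\exp(\alpha^T(X-\mathbb{E}X))\big]\le \exp\big(\tfrac12K^2\|\alpha\|^2\big)$ for all $\alpha\in\mathbb{R}^d$; $\mathcal{F}^{(\mathsf{SG})}_{d,K}$ is the class of all $K$-subgaussian distributions on $\mathbb{R}^d$. $\mathcal{N}_\sigma=\mathcal{N}(0,\sigma^2\mathrm{I}_d)$, $\ast$ is convolution, and $h(\cdot)$ is differential entropy. For a class $\mathcal{F}$ of distributions on $\mathbb{R}^d$, the minimax absolute-error risk is $$\mathcal{R}^\star(n,\sigma,\mathcal{F})=\inf_{\hat h}\sup_{P\in\mathcal{F}}\mathbb{E}\big|h(P\ast\mathcal{N}_\sigma)-\hat h(S^n,\sigma)\big|,$$ where $S^n=(S_1,\dots,S_n)\sim P^{\otimes n}$ and the infimum is over all estimators $\hat h$ (measurable functions of the samples, with $\sigma$ known). The constant implied by $\Omega$ may depend on $\sigma$, $K$, $d$ but not on $n$. *)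

(* Defs.v *)
From HB Require Import structures.
From mathcomp Require Import all_boot all_order all_algebra.
From mathcomp Require Import all_classical all_reals all_analysis.
From mathcomp Require Import measurable_realfun.

Set Implicit Arguments.
Unset Strict Implicit.
Unset Printing Implicit Defensive.

Import Order.TTheory GRing.Theory Num.Theory.
Import numFieldNormedType.Exports.

Local Open Scope classical_set_scope.
Local Open Scope ring_scope.
Local Open Scope ereal_scope.

Section tuple_cons.
Context d (T : measurableType d) (n : nat).

Definition tuple_cons (x : T * n.-tuple T) : n.+1.-tuple T :=
  [tuple of x.1 :: x.2].

Lemma measurable_tuple_cons : measurable_fun [set: T * n.-tuple T] tuple_cons.
Proof. exact: measurable_cons. Qed.

HB.instance Definition _ :=
  isMeasurableFun.Build _ _ _ _ tuple_cons measurable_tuple_cons.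

End tuple_cons.

Section cons_measure.
Context d (T : measurableType d) (R : realType) (n : nat).
Variables (mu : {sigma_finite_measure set T -> \bar R})
          (nu : {sigma_finite_measure set (n.-tuple T) -> \bar R}).

Definition cons_measure : set (n.+1.-tuple T) -> \bar R :=
  pushforward (mu \x nu) (@tuple_cons _ T n).

Let preimage_tuple_cons_measurable A :
  measurable A -> measurable (@tuple_cons _ T n @^-1` A).
Proof.
by move=> mA; rewrite -[X in measurable X]setTI; exact: measurable_tuple_cons.
Qed.

Let cons_measure0 : cons_measure set0 = 0.
Proof. by rewrite /cons_measure /pushforward preimage_set0 measure0. Qed.

Let cons_measure_ge0 A : 0 <= cons_measure A.
Proof. exact: measure_ge0. Qed.

Let cons_measure_sigma_additive : semi_sigma_additive cons_measure.
Proof.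
move=> F mF tF mUF; rewrite /cons_measure /pushforward preimage_bigcup.
apply: measure_semi_sigma_additive.
- by move=> k; exact: preimage_tuple_cons_measurable.
- apply/trivIsetP => /= i j _ _ ij; rewrite -preimage_setI.
  by move/trivIsetP : tF => /(_ _ _ _ _ ij) ->//; rewrite preimage_set0.
- by rewrite -preimage_bigcup; exact: preimage_tuple_cons_measurable.
Qed.

HB.instance Definition _ := isMeasure.Build _ _ _ cons_measure
  cons_measure0 cons_measure_ge0 cons_measure_sigma_additive.

Let cons_measure_sigma_finite : sigma_finite setT cons_measure.
Proof.
have /sigma_finiteP[F [TF ndF Foo]] := sigma_finiteT mu.
have /sigma_finiteP[G [TG ndG Goo]] := sigma_finiteT nu.
pose uncons (t : n.+1.-tuple T) : T * n.-tuple T :=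
  (thead t, [tuple of behead t]).
have muncons : measurable_fun setT uncons.
  apply: measurable_fun_pair; first exact: measurable_tnth.
  exact: measurable_behead.
have unconsK x : uncons (tuple_cons x) = x.
  by case: x => x t; congr (_, _); apply: val_inj.
exists (fun k => uncons @^-1` (F k `*` G k)).
  apply/seteqP; split => // t _.
  have [i _ Fi] : (\bigcup_i F i) (uncons t).1 by rewrite -TF.
  have [j _ Gj] : (\bigcup_j G j) (uncons t).2 by rewrite -TG.
  exists (maxn i j) => //; split.
  - by move: Fi; exact/subsetPset/ndF/leq_maxl.
  - by move: Gj; exact/subsetPset/ndG/leq_maxr.
move=> k; have [mF muF] := Foo k; have [mG nuG] := Goo k; split.
  by rewrite -[X in measurable X]setTI; apply: muncons => //; exact: measurableX.
rewrite /cons_measure /pushforward (_ : _ @^-1` _ = F k `*` G k); last first.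
  by apply/funext => x; rewrite /preimage /mkset unconsK.
by rewrite product_measure1E// lte_mul_pinfty// ge0_fin_numE.
Qed.

HB.instance Definition _ := Measure_isSigmaFinite.Build _ _ _ cons_measure
  cons_measure_sigma_finite.

Lemma cons_measure_setT : mu setT = 1 -> nu setT = 1 -> cons_measure setT = 1.
Proof.
move=> mu1 nu1; rewrite /cons_measure /pushforward preimage_setT -setXTT.
transitivity (mu setT * nu setT); first exact: product_measure1E.
by rewrite mu1 nu1 mule1.
Qed.

End cons_measure.

Section power_measure.
Context d (T : measurableType d) (R : realType).

Fixpoint power_measure_rec (mu : {sigma_finite_measure set T -> \bar R}) n :
    {sigma_finite_measure set (n.-tuple T) -> \bar R} :=
  match n with
  | 0%N => \d_[tuple]
  | n.+1 => cons_measure mu (power_measure_rec mu n)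
  end.

(* Wrapper around the fixpoint, which cannot itself carry structures. *)
Definition power_measure (mu : {sigma_finite_measure set T -> \bar R}) n :
  set (n.-tuple T) -> \bar R := power_measure_rec mu n.
Arguments power_measure mu n _ : clear implicits.

HB.instance Definition _ (mu : {sigma_finite_measure set T -> \bar R}) n :=
  SigmaFiniteMeasure.on (power_measure mu n).

Lemma power_measure_setT (P : probability T R) n :
  power_measure P n setT = 1.
Proof.
elim: n => [|n IHn]; first by rewrite /power_measure/= diracT.
by apply: cons_measure_setT => //; exact: probability_setT.
Qed.

HB.instance Definition _ (P : probability T R) n :=
  Measure_isProbability.Build _ _ _ (power_measure P n)
    (power_measure_setT P n).

End power_measure.
Arguments power_measure {d T R} mu n _.

(* Matrices carry no measurable structure in the library; tuples carry the
   product sigma-algebra, which on R^d is the Borel one. *)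
Notation Rd R d := (d.-tuple (measurableTypeR R)).

Section vectors.
Context (R : realType) (d : nat).
Implicit Types x y : Rd R d.

Definition addRd (xy : Rd R d * Rd R d) : Rd R d :=
  [tuple (tnth xy.1 i + tnth xy.2 i)%R | i < d].

Definition subRd x y : Rd R d := [tuple (tnth x i - tnth y i)%R | i < d].

Definition dotRd x y : R := (\sum_(i < d) tnth x i * tnth y i)%R.

Definition normRd x : R := Num.sqrt (dotRd x x).

Lemma measurable_addRd : measurable_fun setT addRd.
Proof.
apply/measurable_fun_tnthP => i.
rewrite (_ : _ \o _ = fun xy : Rd R d * Rd R d =>
    (tnth xy.1 i : R) + (tnth xy.2 i : R))%R; last first.
  by apply/funext => xy /=; rewrite tnth_mktuple.
apply: measurable_funD.
- exact: (measurableT_comp (measurable_tnth i) measurable_fst).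
- exact: (measurableT_comp (measurable_tnth i) measurable_snd).
Qed.

HB.instance Definition _ := isMeasurableFun.Build _ _ _ _ addRd measurable_addRd.

End vectors.

Section entropy.
Context (R : realType) (d : nat).

Definition lebesgue_Rd : {sigma_finite_measure set (Rd R d) -> \bar R} :=
  power_measure (@lebesgue_measure R) d.

(* N(0, sigma^2 I_d) has independent N(0, sigma^2) coordinates; the second
   argument of [normal_prob] is the standard deviation. *)
Definition gaussian (sigma : R) : probability (Rd R d) R :=
  power_measure (normal_prob 0 sigma) d.

Definition convolution (P Q : probability (Rd R d) R) :
    probability (Rd R d) R :=
  distribution (P \x Q) (@addRd R d).

Definition density (P : probability (Rd R d) R) : Rd R d -> \bar R :=
  Radon_Nikodym (charge_of_finite_measure P) lebesgue_Rd.

(* The integrand vanishes where the density does, since 0 * -oo = 0. If P has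
   no density, the library's derivative is constantly -oo, which gives the
   usual convention h(P) = -oo. *)
Definition entropy (P : probability (Rd R d) R) : \bar R :=
  - \int[lebesgue_Rd]_x (density P x * lne (density P x)).

End entropy.

Section minimax.
Context (R : realType) (d : nat).
Implicit Types P : probability (Rd R d) R.

Definition integrable_coords P :=
  forall i : 'I_d, P.-integrable setT (fun x : Rd R d => (tnth x i : R)%:E).

Definition mean P : Rd R d :=
  [tuple fine ('E_P[fun x : Rd R d => (tnth x i : R)]) | i < d].

Definition subgaussian (K : R) : set (probability (Rd R d) R) :=
  [set P | integrable_coords P /\ forall alpha : Rd R d,
    'E_P[fun x => expR (dotRd alpha (subRd x (mean P)))] <=
    (expR (2^-1 * K ^+ 2 * normRd alpha ^+ 2))%:E].

Definition estimator n := {mfun n.-tuple (Rd R d) >-> R}.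

Definition risk n (sigma : R) (hhat : estimator n) P : \bar R :=
  \int[power_measure P n]_s
    `|entropy (convolution P (gaussian d sigma)) - (hhat s)%:E|.

(* The infimum is taken for a fixed sigma, so estimators may depend on it. *)
Definition minimax_risk n (sigma : R) (F : set (probability (Rd R d) R)) :
    \bar R :=
  ereal_inf [set ereal_sup [set risk sigma hhat P | P in F]
            | hhat in [set: estimator n]].

End minimax.

(* Main.v *)
Require Import Defs.
From mathcomp Require Import all_boot all_order all_algebra.
From mathcomp Require Import all_classical all_reals all_analysis.
From mathcomp Require Import measurable_realfun ring lra.

Set Implicit Arguments.
Unset Strict Implicit.
Unset Printing Implicit Defensive.

Import Order.TTheory GRing.Theory Num.Theory.
Import numFieldNormedType.Exports.

Local Open Scope classical_set_scope.
Local Open Scope ring_scope.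

(** The bound is Le Cam's two-point method applied to two centred Gaussians.
    Take P_0 = N(0, v I_d) and P_1 = N(0, v (1 + u) I_d) with v = K^2 / 2 and
    u = 1 / sqrt (2 d n). As u < 1, both variances are at most K^2, so both laws
    are K-subgaussian ([gaussian_subgaussian]).

    Smoothing by N(0, sigma^2 I_d) keeps the laws Gaussian and adds sigma^2 to
    the variance ([gaussian_convolution]), so the two target entropies are
    explicit up to a constant common to both ([entropy_smoothed_gaussian]).
    They differ by d/2 ln (1 + rho u) with rho = v / (sigma^2 + v), which is at
    least d rho u / 4 ([ln_normal_peak_gap]), hence of order 1 / sqrt n.

    The two laws nevertheless cannot be told apart from n samples. The second
    moment of the likelihood ratio dP_1 / dP_0 is multiplicative over
    independent coordinates ([chi2_power]). It is 1 / sqrt (1 - u^2) for one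
    real coordinate ([normal_ratio_chi2_le]), and Bernoulli's inequality
    with d n u^2 = 1/2 bounds it by 2 for the n samples.
    By [le_cam_chi2] the two risks of any estimator then sum to at least half
    of the entropy gap, hence to at least d rho u / 8, and the larger of the two
    risks is at least d rho u / 16.

    Integrals against power measures are reduced to one coordinate by Tonelli's
    theorem, peeling off the first entry of a tuple at a time
    ([ge0_integral_powerS]). Densities are manipulated through the integral
    identity [has_density], which tensorizes ([has_density_power]);
    Radon-Nikodym derivatives serve to derive it from a density on sets
    ([measure_has_density]) and to reach the entropy. *)

(** * Densities of measures *)

Section densities.
Context d (T : measurableType d) (R : realType).
Implicit Types mu : {sigma_finite_measure set T -> \bar R}.

(** Phrased on integrals of nonnegative functions rather than on sets, so that
    it composes with Tonelli's theorem without any approximation argument. *)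
Definition has_density (nu mu : set T -> \bar R) (g : T -> R) :=
  forall f : T -> \bar R, measurable_fun setT f -> (forall x, 0 <= f x)%E ->
    (\int[nu]_x f x = \int[mu]_x (f x * (g x)%:E))%E.

Lemma has_density_measure (nu : {measure set T -> \bar R}) mu g (A : set T) :
  has_density nu mu g -> measurable A ->
  (nu A = \int[mu]_(x in A) (g x)%:E)%E.
Proof.
move=> nug mA; rewrite -[A in LHS]setIT -integral_indic//.
rewrite nug//; last exact/measurable_EFinP/measurable_indic.
rewrite [RHS]integral_mkcond; apply: eq_integral => x _.
by rewrite epatch_indic muleC.
Qed.

Lemma dominates_density (nu : {measure set T -> \bar R}) mu g :
  measurable_fun setT g ->
  (forall A, measurable A -> (nu A = \int[mu]_(x in A) (g x)%:E)%E) ->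
  nu `<< mu.
Proof.
move=> mg nug; apply/null_content_dominatesP => A mA muA0.
rewrite nug//; apply: null_set_integral => //.
exact/measurable_funTS/measurable_EFinP.
Qed.

Lemma ae_eq_Radon_Nikodym (nu : {finite_measure set T -> \bar R}) mu g :
  measurable_fun setT g ->
  (forall A, measurable A -> (nu A = \int[mu]_(x in A) (g x)%:E)%E) ->
  ae_eq mu setT (Radon_Nikodym (charge_of_finite_measure nu) mu) (EFin \o g).
Proof.
move=> mg nug; have dom := dominates_density mg nug.
apply: integral_ae_eq => //.
- exact: Radon_Nikodym_integrable.
- exact/measurable_EFinP.
- by move=> A _ mA; rewrite -Radon_Nikodym_integral//; exact: nug.
Qed.

Lemma measure_has_density (nu : {finite_measure set T -> \bar R}) mu g :
  measurable_fun setT g ->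
  (forall A, measurable A -> (nu A = \int[mu]_(x in A) (g x)%:E)%E) ->
  has_density nu mu g.
Proof.
move=> mg nug f mf f0; have dom := dominates_density mg nug.
rewrite -(Radon_Nikodym_SigmaFinite.change_of_variables dom)//.
have mRN := measurable_int _ (Radon_Nikodym_SigmaFinite.f_integrable dom).
apply: ae_eq_integral => //.
- exact: emeasurable_funM.
- by apply: emeasurable_funM => //; exact/measurable_EFinP.
- apply: ae_eqe_mul2l.
  have h1 := ae_eq_Radon_Nikodym_SigmaFinite dom measurableT.
  by have h2 := ae_eq_Radon_Nikodym mg nug; exact: ae_eq_trans h1 h2.
Qed.

End densities.

(** * Integration against power measures *)

Section power_measure_integral.
Context d (T : measurableType d) (R : realType).
Implicit Types mu nu : {sigma_finite_measure set T -> \bar R}.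
Local Open Scope ereal_scope.

Lemma ge0_integral_power0 mu (f : 0.-tuple T -> \bar R) :
  measurable_fun setT f -> (forall t, 0 <= f t) ->
  \int[power_measure mu 0]_t f t = f [tuple].
Proof.
move=> mf f0; rewrite /power_measure/=.
by rewrite integral_dirac// diracT mul1e.
Qed.

(** Tonelli's theorem for the first entry of the tuple; every induction on the
    number of entries goes through this step. *)
Lemma ge0_integral_powerS mu n (f : n.+1.-tuple T -> \bar R) :
  measurable_fun setT f -> (forall t, 0 <= f t) ->
  \int[power_measure mu n.+1]_t f t =
  \int[mu]_x \int[power_measure mu n]_t f (tuple_cons (x, t)).
Proof.
move=> mf f0; rewrite /power_measure/= /cons_measure.
rewrite ge0_integral_pushforward//=.
rewrite preimage_setT fubini_tonelli1//.
exact: measurableT_comp mf (@measurable_tuple_cons _ _ _).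
Qed.

Lemma measurable_power_inner mu n (f : n.+1.-tuple T -> \bar R) :
  measurable_fun setT f -> (forall t, 0 <= f t) ->
  measurable_fun setT
    (fun x => \int[power_measure mu n]_t f (tuple_cons (x, t))).
Proof.
move=> mf f0.
apply: ((measurable_fun_fubini_tonelli_F (m2 := power_measure mu n)
  (f \o @tuple_cons _ T n))) => [|x]; last exact: f0.
exact: measurableT_comp mf (@measurable_tuple_cons _ _ _).
Qed.

Lemma measurable_cons_slice n (f : n.+1.-tuple T -> \bar R) x :
  measurable_fun setT f -> measurable_fun setT (fun t => f (tuple_cons (x, t))).
Proof.
move=> mf; apply: measurableT_comp mf _.
apply: measurableT_comp; first exact: measurable_tuple_cons.
exact: pair1_measurable.
Qed.

Lemma measurable_prod_coord n (g : 'I_n -> T -> R) :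
  (forall i, measurable_fun setT (g i)) ->
  measurable_fun setT (fun t : n.-tuple T => \prod_(i < n) g i (tnth t i))%R.
Proof.
move=> mg; apply: measurable_prod => i _.
exact: measurableT_comp (mg i) (measurable_tnth i).
Qed.

Lemma prod_tuple_cons n (g : 'I_n.+1 -> T -> R) x (t : n.-tuple T) :
  (\prod_(i < n.+1) g i (tnth (tuple_cons (x, t)) i) =
   g ord0 x * \prod_(i < n) g (lift ord0 i) (tnth t i))%R.
Proof.
rewrite big_ord_recl; congr (_ * _)%R; apply: eq_bigr => i _.
by congr (g _ _); rewrite !(tnth_nth x).
Qed.

(** The factors may differ from one coordinate to the next: exponential tilts
    by a vector and single-coordinate marginals are both of this form. *)
Lemma integral_power_prod mu n (g : 'I_n -> T -> R) (c : 'I_n -> R) :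
  (forall i, measurable_fun setT (g i)) -> (forall i x, 0 <= g i x)%R ->
  (forall i, \int[mu]_x (g i x)%:E = (c i)%:E) ->
  \int[power_measure mu n]_t (\prod_(i < n) g i (tnth t i))%:E =
  (\prod_(i < n) c i)%:E.
Proof.
elim: n g c => [|n IHn] g c mg g0 gc.
  rewrite ge0_integral_power0; first by rewrite !big_ord0.
    by apply/measurable_EFinP; exact: measurable_prod_coord.
  by move=> t; rewrite big_ord0 lee_fin.
have G0 (t : n.-tuple T) : 0 <= (\prod_(i < n) g (lift ord0 i) (tnth t i))%:E.
  by rewrite lee_fin prodr_ge0.
rewrite ge0_integral_powerS; last 2 first.
- by apply/measurable_EFinP; exact: measurable_prod_coord.
- by move=> t; rewrite lee_fin prodr_ge0.
transitivity (\int[mu]_x ((g ord0 x)%:E *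
    (\prod_(i < n) c (lift ord0 i))%:E)).
  apply: eq_integral => x _.
  under eq_integral do rewrite prod_tuple_cons EFinM.
  rewrite ge0_integralZl ?lee_fin//.
  - by rewrite (IHn (fun i => g (lift ord0 i)) (fun i => c (lift ord0 i))).
  - apply/measurable_EFinP.
    exact: (measurable_prod_coord (g := fun i => g (lift ord0 i))).
have c0 i : (0 <= c i)%R.
  by rewrite -lee_fin -gc integral_ge0// => x _; rewrite lee_fin.
rewrite ge0_integralZr//.
- by rewrite gc -EFinM [in RHS]big_ord_recl.
- exact/measurable_EFinP.
- by move=> x _; rewrite lee_fin.
- by rewrite lee_fin prodr_ge0.
Qed.

(** Used at two levels: from a real coordinate to a vector of R^d, and from one
    vector to the n samples. *)
Lemma has_density_power mu nu n (g : T -> R) :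
  measurable_fun setT g -> (forall x, 0 <= g x)%R -> has_density nu mu g ->
  has_density (power_measure nu n) (power_measure mu n)
    (fun t => \prod_(i < n) g (tnth t i))%R.
Proof.
move=> mg g0 nug; elim: n => [|n IHn] f mf f0.
  rewrite !ge0_integral_power0//; first by rewrite big_ord0 mule1.
  - apply: emeasurable_funM => //.
    by apply/measurable_EFinP; exact: (measurable_prod_coord (g := fun=> g)).
  - by move=> t; rewrite mule_ge0// lee_fin prodr_ge0.
rewrite ge0_integral_powerS// nug; last 2 first.
- exact: measurable_power_inner.
- by move=> x; apply: integral_ge0.
rewrite ge0_integral_powerS; last 2 first.
- apply: emeasurable_funM => //.
  by apply/measurable_EFinP; exact: (measurable_prod_coord (g := fun=> g)).
- by move=> t; rewrite mule_ge0// lee_fin prodr_ge0.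
apply: eq_integral => x _.
rewrite IHn//; last exact: measurable_cons_slice.
rewrite -ge0_integralZr//; last first.
- by rewrite lee_fin.
- by move=> t _; rewrite mule_ge0// lee_fin prodr_ge0.
- apply: emeasurable_funM; first exact: measurable_cons_slice.
  by apply/measurable_EFinP; exact: (measurable_prod_coord (g := fun=> g)).
apply: eq_integral => t _.
rewrite (prod_tuple_cons (fun=> g)) EFinM -muleA; congr (_ * _).
by rewrite muleC.
Qed.

End power_measure_integral.

(** * Changes of variables on the real line *)

Section affine_change_of_variable.
Context (R : realType).
Local Notation mu := (@lebesgue_measure R).

Lemma measurable_affine (c m : R) :
  measurable_fun setT
    (fun x : measurableTypeR R => c * x + m : measurableTypeR R).
Proof. by apply: measurable_funD => //; exact: measurable_funM. Qed.

(** Lebesgue measure is characterized by its values on half-open intervals,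
    whose preimages under an increasing affine map are again such intervals. *)
Lemma lebesgue_measure_affine (c m : R) (A : set R) : 0 < c -> measurable A ->
  (c%:E * mu ((fun x => c * x + m)%R @^-1` A) = mu A)%E.
Proof.
move=> c0 mA.
pose affine (x : measurableTypeR R) : measurableTypeR R := c * x + m.
pose push : {measure set (measurableTypeR R) -> \bar R} :=
  pushforward mu affine.
pose nu : {measure set (measurableTypeR R) -> \bar R} :=
  mscale (NngNum (ltW c0)) (push (measurable_affine c m)).
suff -> : mu A = nu A by [].
apply: lebesgue_measure_unique => // _ [[a b]] _ <-.
transitivity (c%:E * mu (affine @^-1` `]a, b]))%E; last by [].
rewrite (_ : _ @^-1` _ = `](a - m) / c, (b - m) / c]%classic); last first.
  apply/seteqP; split=> x; rewrite /affine /= !in_itv/=;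
  by rewrite ltr_pdivrMr// ler_pdivlMr// ltrBlDr lerBrDr (mulrC x).
rewrite !lebesgue_measure_itv/= !lte_fin ltr_pM2r ?invr_gt0// ltrD2r.
case: ifPn => _; last by rewrite mule0.
by rewrite -!EFinB -EFinM; congr EFin; field; rewrite gt_eqF.
Qed.

Lemma ge0_integral_affine (c m : R) (f : R -> \bar R) : 0 < c ->
  measurable_fun setT f -> (forall x, 0 <= f x)%E ->
  (\int[mu]_x f x = c%:E * \int[mu]_x f (c * x + m)%R)%E.
Proof.
move=> c0 mf f0.
pose affine (x : measurableTypeR R) : measurableTypeR R := c * x + m.
pose push : {measure set (measurableTypeR R) -> \bar R} :=
  pushforward mu affine.
transitivity (\int[mscale (NngNum (ltW c0))
    (push (measurable_affine c m))]_x f x)%E.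
  apply: eq_measure_integral => A mA _.
  exact/esym/lebesgue_measure_affine.
rewrite ge0_integral_mscale//.
by rewrite ge0_integral_pushforward//; exact: measurable_affine.
Qed.

Lemma ge0_integral_reflection (f : R -> \bar R) :
  measurable_fun setT f -> (forall x, 0 <= f x)%E ->
  (\int[mu]_x f x = \int[mu]_x f (- x)%R)%E.
Proof.
move=> mf f0.
transitivity (\int[pushforward mu (-%R : _ -> measurableTypeR R)]_x f x)%E.
  by apply: eq_measure_integral => A mA _; exact/esym/lebesgue_measureN.
by rewrite ge0_integral_pushforward.
Qed.

End affine_change_of_variable.

(** * Identities between normal densities *)

Section normal_density.
Context (R : realType).
Implicit Types (s t x y a m : R).
Local Notation mu := (@lebesgue_measure R).

Lemma normal_peakE s : 0 < s ->
  normal_peak s = s^-1 * (Num.sqrt (pi *+ 2))^-1.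
Proof.
move=> s0; rewrite /normal_peak -mulrnAr sqrtrM ?sqr_ge0// sqrtr_sqr.
by rewrite gtr0_norm// invfM.
Qed.

Lemma sqrt_2pi_gt0 : 0 < Num.sqrt (pi *+ 2) :> R.
Proof. by rewrite sqrtr_gt0 pmulrn_lgt0// pi_gt0. Qed.

Lemma normal_pdf_expR m s x : 0 < s ->
  normal_pdf m s x =
  s^-1 * (Num.sqrt (pi *+ 2))^-1 * expR (- (x - m) ^+ 2 / (s ^+ 2 *+ 2)).
Proof. by move=> s0; rewrite normal_pdfE ?gt_eqF// normal_peakE. Qed.

Lemma normal_pdf_gt0 m s x : 0 < s -> 0 < normal_pdf m s x.
Proof.
move=> s0; rewrite normal_pdf_expR// !mulr_gt0 ?expR_gt0 ?invr_gt0//.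
exact: sqrt_2pi_gt0.
Qed.

Lemma normal_has_density s :
  has_density (normal_prob 0 s) mu (normal_pdf 0 s).
Proof. by apply: measure_has_density => //; exact: measurable_normal_pdf. Qed.

(** Completing the square in x: given that independent centred normals with
    deviations s and t sum to y, the first one is normal with mean
    y s^2 / r^2 and deviation s t / r. *)
Lemma normal_pdf_convolution s t x y : 0 < s -> 0 < t ->
  let r := Num.sqrt (s ^+ 2 + t ^+ 2) in
  normal_pdf 0 s x * normal_pdf 0 t (y - x) =
  normal_pdf 0 r y * normal_pdf (y * s ^+ 2 / r ^+ 2) (s * t / r) x.
Proof.
move=> s0 t0 r.
have r0 : 0 < r by rewrite sqrtr_gt0 addr_gt0// exprn_gt0.
have r2 : r ^+ 2 = s ^+ 2 + t ^+ 2.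
  by rewrite sqr_sqrtr// addr_ge0// sqr_ge0.
have st0 : 0 < s * t / r by rewrite divr_gt0// mulr_gt0.
rewrite !normal_pdf_expR// mulrACA -expRD [RHS]mulrACA -expRD; congr (_ * _).
  by have p0 := sqrt_2pi_gt0; field; rewrite !gt_eqF.
congr expR; rewrite expr_div_n exprMn r2.
by field; rewrite !gt_eqF ?addr_gt0 ?exprn_gt0.
Qed.

(** Exponential tilting shifts the mean; the factor is the moment generating
    function at a. *)
Lemma normal_pdf_tilt s a x : 0 < s ->
  expR (a * x) * normal_pdf 0 s x =
  expR (2^-1 * s ^+ 2 * a ^+ 2) * normal_pdf (s ^+ 2 * a) s x.
Proof.
move=> s0; rewrite !normal_pdf_expR// mulrCA -expRD [RHS]mulrCA -expRD.
by congr (_ * expR _); field; rewrite gt_eqF.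
Qed.

(** Up to a factor, p_1^2 / p_0 is a normal density whose inverse variance is
    twice that of p_1 minus that of p_0. *)
Lemma normal_pdf_chi2 s0 s1 s2 x : 0 < s0 -> 0 < s1 -> 0 < s2 ->
  (s2 ^+ 2)^-1 = 2 * (s1 ^+ 2)^-1 - (s0 ^+ 2)^-1 ->
  (normal_pdf 0 s1 x / normal_pdf 0 s0 x) ^+ 2 * normal_pdf 0 s0 x =
  s0 * s2 / s1 ^+ 2 * normal_pdf 0 s2 x.
Proof.
move=> s00 s10 s20 s2E.
have -> : (normal_pdf 0 s1 x / normal_pdf 0 s0 x) ^+ 2 * normal_pdf 0 s0 x =
    normal_pdf 0 s1 x ^+ 2 / normal_pdf 0 s0 x.
  by field; rewrite gt_eqF// normal_pdf_gt0.
rewrite !normal_pdf_expR// subr0 exprMn invfM -expRN -expRM_natl.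
rewrite mulrACA -expRD [RHS]mulrA; congr (_ * _).
  by have p0 := sqrt_2pi_gt0; field; rewrite !gt_eqF.
congr expR.
rewrite -[s2 ^+ 2 *+ 2]mulr_natr invfM s2E.
by field; rewrite !gt_eqF.
Qed.

Lemma normal_pdf_scale s x : 0 < s ->
  s * normal_pdf 0 s (s * x) = normal_pdf 0 1 x.
Proof.
move=> s0; rewrite !normal_pdf_expR// !subr0 mulrA; congr (_ * expR _).
  by have p0 := sqrt_2pi_gt0; field; rewrite !gt_eqF.
by field; rewrite gt_eqF.
Qed.

End normal_density.

(** * Integrals against normal laws *)

Section normal_integrals.
Context (R : realType).
Implicit Types (s t x y a m : R).
Local Notation mu := (@lebesgue_measure R).
Local Open Scope ereal_scope.

Lemma normal_convolution1 s t (h : R -> \bar R) : (0 < s)%R -> (0 < t)%R ->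
  measurable_fun setT h -> (forall x, 0 <= h x) ->
  \int[normal_prob 0 s]_x \int[normal_prob 0 t]_y h (x + y)%R =
  \int[normal_prob 0 (Num.sqrt (s ^+ 2 + t ^+ 2)%R)]_z h z.
Proof.
move=> s0 t0 mh h0; set r := Num.sqrt _.
have mhD : measurable_fun setT (fun z : R * R => h (z.1 + z.2)%R).
  apply: measurableT_comp mh _.
  by apply: measurable_funD; [exact: measurable_fst|exact: measurable_snd].
have mhx x : measurable_fun setT (fun y => h (x + y)%R).
  by apply: measurableT_comp mh _; exact: measurable_funD.
have mp m u : measurable_fun setT (fun x => (normal_pdf m u x)%:E).
  by apply/measurable_EFinP; exact: measurable_normal_pdf.
have p0 m u x : 0 <= (normal_pdf m u x)%:E by rewrite lee_fin normal_pdf_ge0.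
rewrite normal_has_density; last 2 first.
- have := measurable_fun_fubini_tonelli_F (m2 := normal_prob 0 t) _ mhD.
  exact.
- by move=> x; exact: integral_ge0.
(* translate the inner variable by x, so that h no longer depends on x *)
transitivity (\int[mu]_x \int[mu]_y
    (h y * (normal_pdf 0 s x * normal_pdf 0 t (y - x))%:E)).
  apply: eq_integral => x _; rewrite normal_has_density//; last exact: mhx.
  rewrite (ge0_integral_affine (c := 1) (- x)%R)//; last 2 first.
  - exact: emeasurable_funM.
  - by move=> y; rewrite mule_ge0.
  rewrite mul1e -ge0_integralZr//; last 2 first.
  - apply: (measurableT_comp
      (f := fun y => h (x + y)%R * (normal_pdf 0 t y)%:E)).
      exact: emeasurable_funM.
    exact: measurable_affine.
  - by move=> y _; rewrite mule_ge0.
  apply: eq_integral => y _; rewrite mul1r subrKC -muleA -EFinM.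
  by rewrite (mulrC (normal_pdf 0 s x)).
transitivity (\int[mu]_y \int[mu]_x
    (h y * (normal_pdf 0 s x * normal_pdf 0 t (y - x))%:E)).
  apply: (fubini_tonelli (m1 := mu) (m2 := mu)
      (fun z : measurableTypeR R * measurableTypeR R => h z.2 *
        (normal_pdf 0 s z.1 * normal_pdf 0 t (z.2 - z.1))%:E)).
    apply: emeasurable_funM; first exact: measurableT_comp mh measurable_snd.
    apply/measurable_EFinP; apply: measurable_funM.
      exact: measurableT_comp (measurable_normal_pdf _ _) measurable_fst.
    apply: measurableT_comp (measurable_normal_pdf _ _) _.
    by apply: measurable_funB; [exact: measurable_snd|exact: measurable_fst].
  by move=> z; rewrite mule_ge0// lee_fin mulr_ge0 ?normal_pdf_ge0.
rewrite normal_has_density//; apply: eq_integral => y _.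
under eq_integral do rewrite normal_pdf_convolution// -/r EFinM muleA.
rewrite ge0_integralZl//; [|exact: mp|by rewrite mule_ge0].
by rewrite integral_normal_pdf mule1.
Qed.

Lemma measurable_expRM a : measurable_fun setT (fun x : R => (expR (a * x))%:E).
Proof.
by apply/measurable_EFinP; apply: measurableT_comp.
Qed.

Lemma integral_expR_normal s a : (0 < s)%R ->
  \int[normal_prob 0 s]_x (expR (a * x))%:E =
  (expR (2^-1 * s ^+ 2 * a ^+ 2))%:E.
Proof.
move=> s0; rewrite normal_has_density; last 2 first.
- exact: measurable_expRM.
- by move=> x; rewrite lee_fin expR_ge0.
under eq_integral do rewrite -EFinM normal_pdf_tilt// EFinM.
rewrite ge0_integralZl ?integral_normal_pdf ?mule1 ?lee_fin ?expR_ge0//.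
- by apply/measurable_EFinP; exact: measurable_normal_pdf.
- by move=> x _; rewrite lee_fin normal_pdf_ge0.
Qed.

(** By symmetry the positive and negative parts have the same finite integral,
    which gives both integrability and mean zero. *)
Lemma integral_pos_part_normal s : (0 < s)%R ->
  exists c : R, \int[normal_prob 0 s]_x (Num.max x 0%R)%:E = c%:E /\
    \int[normal_prob 0 s]_x (Num.max (- x)%R 0%R)%:E = c%:E.
Proof.
move=> s0.
have mmax : measurable_fun setT (fun x : R => Num.max x 0%R).
  exact: measurable_maxr.
have mmaxN : measurable_fun setT (fun x : R => Num.max (- x)%R 0%R).
  by apply: measurable_maxr => //; exact: measurableT_comp.
have max0 (x : R) : (0 <= Num.max x 0%R)%R by rewrite le_max lexx orbT.
have fin : \int[normal_prob 0 s]_x (Num.max x 0%R)%:E \is a fin_num.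
  rewrite ge0_fin_numE; last by apply: integral_ge0 => x _; rewrite lee_fin.
  apply: (@le_lt_trans _ _ (\int[normal_prob 0 s]_x (expR (1 * x))%:E)).
    apply: ge0_le_integral => //.
    - by move=> x _; rewrite lee_fin.
    - exact/measurable_EFinP.
    - exact: measurable_expRM.
    - move=> x _; rewrite lee_fin mul1r ge_max expR_ge0 andbT.
      by apply: le_trans (expR_ge1Dx x); rewrite lerDr.
  by rewrite integral_expR_normal// ltry.
exists (fine (\int[normal_prob 0 s]_x (Num.max x 0%R)%:E)).
rewrite fineK//; split=> //.
rewrite !normal_has_density//; last 3 first.
- exact/measurable_EFinP.
- exact/measurable_EFinP.
- by move=> x; rewrite lee_fin.
rewrite [RHS]ge0_integral_reflection.
- apply: eq_integral => x _; congr (_ * _%:E).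
  by rewrite !normal_pdf_expR// !subr0 sqrrN.
- apply: emeasurable_funM; first exact/measurable_EFinP.
  by apply/measurable_EFinP; exact: measurable_normal_pdf.
- by move=> x; rewrite mule_ge0 ?lee_fin ?normal_pdf_ge0.
Qed.

Lemma sqr_le_expR x : (x ^+ 2 <= 2 * (expR x + expR (- x)))%R.
Proof.
wlog x0 : x / (0 <= x)%R => [hwlog|].
  have [|/ltW x0] := leP 0%R x; first exact: hwlog.
  have := hwlog (- x)%R; rewrite sqrrN opprK addrC; apply.
  by rewrite oppr_ge0.
have := expR_ge1Dxn 1 x0; have := expR_gt0 (- x).
rewrite (_ : 2`!%:R = 2 :> R)%R//; lra.
Qed.

(** The substitution x = s y reduces every deviation to the standard one. The
    constant M will cancel in the difference of two entropies. *)
Lemma integral_sqr_normal :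
  exists M : R, forall s, (0 < s)%R ->
    \int[normal_prob 0 s]_x (x ^+ 2)%:E = (s ^+ 2 * M)%:E.
Proof.
have msqr : measurable_fun setT (fun x : R => (x ^+ 2)%:E).
  by apply/measurable_EFinP; exact: measurable_funX.
have sqr0 (x : R) : 0 <= (x ^+ 2)%:E by rewrite lee_fin sqr_ge0.
have fin : \int[normal_prob 0 (1 : R)]_x (x ^+ 2)%:E \is a fin_num.
  rewrite ge0_fin_numE; last by apply: integral_ge0.
  apply: (@le_lt_trans _ _ (\int[normal_prob 0 (1 : R)]_x
      (2%:E * ((expR (1 * x))%:E + (expR (-1 * x))%:E)))).
    apply: ge0_le_integral => //.
    - apply: emeasurable_funM => //.
      by apply: emeasurable_funD; exact: measurable_expRM.
    - move=> x _; rewrite -EFinD -EFinM lee_fin mul1r mulN1r.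
      exact: sqr_le_expR.
  rewrite ge0_integralZl//; last 2 first.
  - by apply: emeasurable_funD; exact: measurable_expRM.
  - by move=> x _; rewrite adde_ge0// lee_fin expR_ge0.
  rewrite ge0_integralD//; [|exact: measurable_expRM..].
  by rewrite !integral_expR_normal// -EFinD -EFinM ltry.
exists (fine (\int[normal_prob 0 (1 : R)]_x (x ^+ 2)%:E)) => s s0.
rewrite EFinM fineK// !normal_has_density//.
have mf u : measurable_fun setT
    (fun x : R => (x ^+ 2)%:E * (normal_pdf 0 u x)%:E).
  apply: emeasurable_funM => //; apply/measurable_EFinP.
  exact: measurable_normal_pdf.
have f0 u x : 0 <= (x ^+ 2)%:E * (normal_pdf 0 u x)%:E.
  by rewrite mule_ge0// lee_fin normal_pdf_ge0.
rewrite (ge0_integral_affine 0%R s0 (mf s) (f0 s)).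
have mfs : measurable_fun setT (fun x : R =>
    ((s * x + 0) ^+ 2)%:E * (normal_pdf 0 s (s * x + 0))%:E).
  exact: measurableT_comp (mf s) (measurable_affine s 0%R).
rewrite -ge0_integralZl; [|exact: measurableT|exact: mfs|by []|].
2: by rewrite lee_fin ltW.
rewrite -ge0_integralZl; [|exact: measurableT|exact: mf|by []|by []].
apply: eq_integral => x _; rewrite addr0 -!EFinM -(normal_pdf_scale x s0).
by congr EFin; ring.
Qed.

End normal_integrals.

(** * Sums of independent Gaussian vectors *)

Section gaussian_vectors.
Context (R : realType).
Local Open Scope ereal_scope.

Lemma addRd_cons n (x y : R) (t u : Rd R n) :
  addRd (tuple_cons (x : measurableTypeR R, t),
         tuple_cons (y : measurableTypeR R, u)) =
  tuple_cons ((x + y)%R : measurableTypeR R, addRd (t, u)).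
Proof.
apply: eq_from_tnth => i; rewrite tnth_mktuple /=.
case: (unliftP ord0 i) => [j ->|->]; last by rewrite !tnth0.
by rewrite !tnthS tnth_mktuple.
Qed.

(** By induction on the dimension: Tonelli's theorem brings the two first
    coordinates together, and [normal_convolution1] adds them. *)
Lemma gaussian_convolution n (s t : R) (f : Rd R n -> \bar R) :
  (0 < s)%R -> (0 < t)%R ->
  measurable_fun setT f -> (forall x, 0 <= f x) ->
  \int[gaussian n s]_x \int[gaussian n t]_y f (addRd (x, y)) =
  \int[gaussian n (Num.sqrt (s ^+ 2 + t ^+ 2)%R)]_z f z.
Proof.
move=> s0 t0; rewrite /gaussian; set r := Num.sqrt _.
elim: n f => [|n IHn] f mf f0.
  rewrite !ge0_integral_power0//.
  - by rewrite (tuple0 (addRd _)).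
  - apply: measurableT_comp mf _.
    exact: measurableT_comp (@measurable_addRd _ _) (pair1_measurable _).
  - have := measurable_fun_fubini_tonelli_F
      (m2 := power_measure (normal_prob 0 t) 0) (f \o @addRd R 0); apply.
      exact: measurableT_comp mf (@measurable_addRd _ _).
    by move=> z; exact: f0.
  - by move=> x; apply: integral_ge0.
have mfadd : measurable_fun setT (fun z : Rd R n.+1 * Rd R n.+1 => f (addRd z)).
  exact: measurableT_comp mf (@measurable_addRd _ _).
have mfinner : measurable_fun setT (fun x : Rd R n.+1 =>
    \int[power_measure (normal_prob 0 t) n.+1]_y f (addRd (x, y))).
  by have := measurable_fun_fubini_tonelli_F
    (m2 := power_measure (normal_prob 0 t) n.+1) _ mfadd; apply => z; exact: f0.
etransitivity.
  apply: (ge0_integral_powerS (normal_prob 0 s) mfinner) => x.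
  exact: integral_ge0.
etransitivity; last first.
  exact/esym/(ge0_integral_powerS (normal_prob 0 r) mf).
have mtail := measurable_power_inner (normal_prob 0 r) mf f0.
rewrite -(normal_convolution1 s0 t0 mtail); last first.
  by move=> x; apply: integral_ge0.
apply: eq_integral => x0 _.
(* exchange the tail of the first vector with the head of the second, so that
   heads meet heads and tails meet tails *)
have mfc : measurable_fun setT
    (fun z : (Rd R n * measurableTypeR R) * Rd R n =>
       f (tuple_cons ((x0 + z.1.2)%R : measurableTypeR R, addRd (z.1.1, z.2)))).
  apply: measurableT_comp mf _; apply: measurableT_comp.
    exact: measurable_tuple_cons.
  apply: measurable_fun_pair => /=.
    apply: measurable_funD => //.
    exact: measurableT_comp measurable_snd measurable_fst.
  apply: measurableT_comp; first exact: measurable_addRd.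
  apply: measurable_fun_pair => //=.
  exact: measurableT_comp measurable_fst measurable_fst.
transitivity (\int[power_measure (normal_prob 0 s) n]_x \int[normal_prob 0 t]_y0
    \int[power_measure (normal_prob 0 t) n]_y
      f (tuple_cons ((x0 + y0)%R : measurableTypeR R, addRd (x, y)))).
  apply: eq_integral => x _; rewrite ge0_integral_powerS//; last first.
    by apply: measurableT_comp mfadd _; exact: pair1_measurable.
  by apply: eq_integral => y0 _; apply: eq_integral => y _; rewrite addRd_cons.
have := fubini_tonelli (m1 := power_measure (normal_prob 0 s) n)
  (m2 := normal_prob 0 t) (fun z : Rd R n * measurableTypeR R =>
    \int[power_measure (normal_prob 0 t) n]_y
      f (tuple_cons ((x0 + z.2)%R : measurableTypeR R, addRd (z.1, y)))).
move=> ->; last 2 first.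
- by have := measurable_fun_fubini_tonelli_F
    (m2 := power_measure (normal_prob 0 t) n) _ mfc; apply.
- by move=> z; apply: integral_ge0.
apply: eq_integral => y0 _ /=.
rewrite (IHn (fun z => f (tuple_cons ((x0 + y0)%R : measurableTypeR R, z))))//.
exact: measurable_cons_slice.
Qed.

End gaussian_vectors.

(** * Moments of Gaussian vectors *)

Section power_marginals.
Context d (T : measurableType d) (R : realType) (P : probability T R).
Local Open Scope ereal_scope.

Lemma integral_power_coord n (i : 'I_n) (g : T -> R) (c : R) :
  measurable_fun setT g -> (forall x, 0 <= g x)%R ->
  \int[P]_x (g x)%:E = c%:E ->
  \int[power_measure P n]_t (g (tnth t i))%:E = c%:E.
Proof.
move=> mg g0 gc.
(* all the other factors of the product are constantly 1 *)
pose h (j : 'I_n) (x : T) : R := if j == i then g x else 1%R.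
pose e (j : 'I_n) : R := if j == i then c else 1%R.
have hE (F : 'I_n -> R) j0 :
    (\prod_(j < n) (if j == j0 then F j else 1) = F j0)%R.
  by rewrite (bigD1 j0)//= eqxx big1 ?mulr1// => j /negbTE ->.
have := @integral_power_prod _ T R P n h e.
rewrite /e (hE (fun=> c)) => <-.
- apply: eq_integral => t _; congr EFin.
  by rewrite /h (hE (fun j => g (tnth t j))).
- by move=> j; rewrite /h; case: (j == i).
- by move=> j x; rewrite /h; case: (j == i).
- move=> j; rewrite /h /e; case: (j == i) => //.
  rewrite integral_cst// mul1e; exact: probability_setT.
Qed.

End power_marginals.

Section gaussian_subgaussian.
Context (R : realType) (n : nat).
Implicit Types s K : R.
Local Open Scope ereal_scope.

Lemma measurable_coord (i : 'I_n) :
  measurable_fun setT (fun x : Rd R n => tnth x i : R).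
Proof. exact: measurable_tnth. Qed.

Lemma gaussian_integral_coord s (i : 'I_n) (g : R -> R) (c : R) :
  measurable_fun setT g -> (forall x, 0 <= g x)%R ->
  \int[normal_prob 0 s]_x (g x)%:E = c%:E ->
  \int[gaussian n s]_t (g (tnth t i))%:E = c%:E.
Proof.
exact: (@integral_power_coord _ (measurableTypeR R) R (normal_prob 0 s) n i g c).
Qed.

Lemma gaussian_coord_parts s (i : 'I_n) : (0 < s)%R -> exists c : R,
  \int[gaussian n s]_x ((fun y : Rd R n => (tnth y i : R)%:E)^\+ x) = c%:E /\
  \int[gaussian n s]_x ((fun y : Rd R n => (tnth y i : R)%:E)^\- x) = c%:E.
Proof.
move=> s0; have [c [cp cn]] := integral_pos_part_normal s0.
have max0 (x : R) : (0 <= Num.max x 0%R)%R by rewrite le_max lexx orbT.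
have mmax : measurable_fun setT (fun x : R => Num.max x 0%R).
  exact: measurable_maxr.
have mmaxN : measurable_fun setT (fun x : R => Num.max (- x)%R 0%R).
  by apply: measurable_maxr => //; exact: measurableT_comp.
exists c; split.
- rewrite -(gaussian_integral_coord i mmax max0 cp).
  by apply: eq_integral => x _; rewrite funeposE EFin_max.
- rewrite -(gaussian_integral_coord i mmaxN (fun x => max0 (- x)%R) cn).
  by apply: eq_integral => x _; rewrite funenegE EFin_max.
Qed.

Lemma gaussian_integrable_coords s :
  (0 < s)%R -> integrable_coords (gaussian n s).
Proof.
move=> s0 i; have [c [cp cn]] := gaussian_coord_parts i s0.
apply/integrableP; split.
  by apply/measurable_EFinP; exact: measurable_coord.
under eq_integral do
  rewrite -[`|_|]/((abse \o fun y : Rd R n => (tnth y i : R)%:E) _) fune_abse.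
rewrite ge0_integralD//.
- by rewrite cp cn -EFinD ltry.
- by apply/measurable_funepos/measurable_EFinP; exact: measurable_coord.
- by apply/measurable_funeneg/measurable_EFinP; exact: measurable_coord.
Qed.

Lemma gaussian_mean s : (0 < s)%R -> mean (gaussian n s) = [tuple 0%R | i < n].
Proof.
move=> s0; apply: eq_from_tnth => i; rewrite !tnth_mktuple.
have [c [cp cn]] := gaussian_coord_parts i s0.
by rewrite unlock integralE cp cn -EFinB subrr.
Qed.

(** The exponential of a scalar product is a product over coordinates, so the
    moment generating function is the product of the one-dimensional ones. *)
Lemma gaussian_subgaussian s K : (0 < s)%R -> (s <= K)%R ->
  subgaussian K (gaussian n s).
Proof.
move=> s0 sK; split; first exact: gaussian_integrable_coords.
move=> alpha; rewrite gaussian_mean// unlock.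
pose g (i : 'I_n) (x : R) := expR (tnth alpha i * x).
have -> : \int[gaussian n s]_x
      (expR (dotRd alpha (subRd x [tuple 0%R | i < n])))%:E =
    \int[gaussian n s]_x (\prod_(i < n) g i (tnth x i))%:E.
  apply: eq_integral => x _; congr EFin.
  rewrite /dotRd expR_sum; apply: eq_bigr => i _.
  by rewrite /g !tnth_mktuple subr0.
rewrite (integral_power_prod
  (c := fun i => expR (2^-1 * s ^+ 2 * tnth alpha i ^+ 2))).
- rewrite lee_fin -expR_sum ler_expR -mulr_sumr.
  rewrite /normRd sqr_sqrtr; last first.
    by apply: sumr_ge0 => i _; rewrite -expr2 sqr_ge0.
  apply: ler_pM => //.
  + by rewrite mulr_ge0 ?sqr_ge0.
  + by apply: sumr_ge0 => i _; rewrite sqr_ge0.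
  + by rewrite ler_pM2l// ler_pXn2r// nnegrE ltW// (lt_le_trans s0).
- by move=> i; apply: measurableT_comp => //; exact: measurable_funM.
- by move=> i x; exact: expR_ge0.
- by move=> i; exact: integral_expR_normal.
Qed.

End gaussian_subgaussian.

(** * Entropy of Gaussian vectors *)

Section gaussian_entropy.
Context (R : realType).
Local Open Scope ereal_scope.

Lemma measurable_lne_fin d (T : measurableType d) (f : T -> \bar R) :
  measurable_fun setT f -> (forall x, f x \is a fin_num) ->
  measurable_fun setT (fun x => lne (f x)).
Proof.
move=> mf ffin.
have -> : (fun x => lne (f x)) =
    (fun x => if (fine (f x) <= 0)%R then -oo else (ln (fine (f x)))%:E).
  by apply/funext => x; rewrite -[in LHS](fineK (ffin x)).
have mff : measurable_fun setT (fine \o f) by exact: measurableT_comp.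
apply: measurable_fun_ifT => //.
- exact: measurable_fun_ler.
- by apply/measurable_EFinP; exact: measurableT_comp mff.
Qed.

Context (n : nat).
Implicit Types (s : R) (t : Rd R n).

Definition gaussian_pdf s t : R := (\prod_(i < n) normal_pdf 0 s (tnth t i))%R.

Definition sqnormRd t : R := (\sum_(i < n) (tnth t i : R) ^+ 2)%R.

Lemma measurable_sqr_coord (i : 'I_n) :
  measurable_fun setT (fun t : Rd R n => (tnth t i : R) ^+ 2)%R.
Proof. exact: (measurable_funX 2 (measurable_coord i)). Qed.

Lemma measurable_gaussian_pdf s : measurable_fun setT (gaussian_pdf s).
Proof.
apply: (measurable_prod_coord (g := fun=> normal_pdf 0 s)) => _.
exact: measurable_normal_pdf.
Qed.

Lemma gaussian_pdf_gt0 s t : (0 < s)%R -> (0 < gaussian_pdf s t)%R.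
Proof. by move=> s0; apply: prodr_gt0 => i _; exact: normal_pdf_gt0. Qed.

Lemma gaussian_has_density s :
  has_density (gaussian n s) (lebesgue_Rd R n) (gaussian_pdf s).
Proof.
apply: has_density_power.
- exact: measurable_normal_pdf.
- by move=> x; exact: normal_pdf_ge0.
- exact: normal_has_density.
Qed.

Lemma ln_gaussian_pdf s t : (0 < s)%R ->
  ln (gaussian_pdf s t) =
  (n%:R * ln (normal_peak s) - (s ^+ 2 *+ 2)^-1 * sqnormRd t)%R.
Proof.
move=> s0; have pk0 : (0 < normal_peak s)%R by rewrite normal_peak_gt0// gt_eqF.
have -> : gaussian_pdf s t = (normal_peak s ^+ n *
    expR (- ((s ^+ 2 *+ 2)^-1 * sqnormRd t)))%R.
  rewrite /gaussian_pdf mulr_sumr -sumrN expR_sum.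
  rewrite -[in (normal_peak s ^+ n)%R](card_ord n) -prodr_const -big_split/=.
  apply: eq_bigr => i _; rewrite normal_pdfE ?gt_eqF// /normal_fun subr0.
  by congr (_ * expR _)%R; rewrite mulNr mulrC.
by rewrite lnM ?posrE ?expR_gt0 ?exprn_gt0// expRK lnXn// mulr_natl.
Qed.

Lemma integral_sqnormRd s M : (0 < s)%R ->
  \int[normal_prob 0 s]_x (x ^+ 2)%:E = (s ^+ 2 * M)%:E ->
  \int[gaussian n s]_t (sqnormRd t)%:E = (n%:R * (s ^+ 2 * M))%:E.
Proof.
move=> s0 sM; rewrite /sqnormRd.
under eq_integral do rewrite -sumEFin.
rewrite ge0_integral_sum//; last 2 first.
- by move=> i; apply/measurable_EFinP; exact: measurable_sqr_coord.
- by move=> i t _; rewrite lee_fin sqr_ge0.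
have msqr : measurable_fun setT (fun x : R => x ^+ 2)%R.
  exact: measurable_funX.
under eq_bigr do
  rewrite (gaussian_integral_coord _ msqr (fun x => sqr_ge0 x) sM).
by rewrite sumEFin sumr_const card_ord mulr_natl.
Qed.

(** The density p of a Gaussian satisfies ln p = A - B |x|^2, so the entropy
    only involves the total mass and the second moment. Any P with this density is
    allowed because the entropy of interest is that of a convolution, which is
    a Gaussian law through its density only. *)
Lemma entropy_gaussian_density (P : probability (Rd R n) R) s M : (0 < s)%R ->
  \int[normal_prob 0 s]_x (x ^+ 2)%:E = (s ^+ 2 * M)%:E ->
  has_density P (lebesgue_Rd R n) (gaussian_pdf s) ->
  entropy P = (n%:R * (M / 2 - ln (normal_peak s)))%:E.
Proof.
move=> s0 sM Pg.
pose g := gaussian_pdf s.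
have mg : measurable_fun setT g := measurable_gaussian_pdf s.
have mq : measurable_fun setT sqnormRd.
  by apply: measurable_sum => i; exact: measurable_sqr_coord.
have g0 t : (0 <= g t)%R by rewrite ltW// gaussian_pdf_gt0.
have q0 t : (0 <= sqnormRd t)%R by apply: sumr_ge0 => i _; exact: sqr_ge0.
have Ig : \int[lebesgue_Rd R n]_t (g t)%:E = 1.
  transitivity (\int[P]_t (cst 1 t)).
    by rewrite Pg//; apply: eq_integral => t _; rewrite mul1e.
  by rewrite integral_cst// mul1e; exact: probability_setT.
have Iq : \int[lebesgue_Rd R n]_t (sqnormRd t * g t)%:E =
    (n%:R * (s ^+ 2 * M))%:E.
  rewrite -(integral_sqnormRd s0 sM) gaussian_has_density//.
  exact/measurable_EFinP.
have ig : (lebesgue_Rd R n).-integrable setT (fun t => (g t)%:E).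
  apply/integrableP; split; first exact/measurable_EFinP.
  under eq_integral do rewrite gee0_abs ?lee_fin//.
  by rewrite Ig ltry.
have iq : (lebesgue_Rd R n).-integrable setT (fun t => (sqnormRd t * g t)%:E).
  apply/integrableP; split.
    by apply/measurable_EFinP; exact: measurable_funM.
  under eq_integral do rewrite gee0_abs ?lee_fin ?mulr_ge0//.
  by rewrite Iq ltry.
pose A : R := (n%:R * ln (normal_peak s))%R.
pose B : R := ((s ^+ 2 *+ 2)^-1)%R.
have dA : \int[lebesgue_Rd R n]_t (density P t * lne (density P t)) =
    \int[lebesgue_Rd R n]_t
      ((fun t => A%:E * (g t)%:E) \- (fun t => B%:E * (sqnormRd t * g t)%:E)) t.
  have Pm (E : set (Rd R n)) : measurable E ->
      P E = \int[lebesgue_Rd R n]_(x in E) (g x)%:E.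
    by move=> mE; exact: has_density_measure.
  have dens : ae_eq (lebesgue_Rd R n) setT (density P) (EFin \o g).
    exact: ae_eq_Radon_Nikodym.
  have dom : charge_of_finite_measure P `<< lebesgue_Rd R n.
    exact: dominates_density mg Pm.
  have md : measurable_fun setT (density P).
    apply: (measurable_int (lebesgue_Rd R n)).
    exact: Radon_Nikodym_integrable.
  apply: ae_eq_integral => //.
  - apply: emeasurable_funM => //; apply: measurable_lne_fin => // x.
    exact: Radon_Nikodym_fin_num.
  - apply: emeasurable_funB; apply: measurable_funeM;
      apply/measurable_EFinP => //.
    exact: measurable_funM.
  - apply: filterS dens => t /(_ I) /= -> _.
    rewrite lne_EFin ?gaussian_pdf_gt0// ln_gaussian_pdf// -/A -/B.
    by rewrite -!EFinM -EFinB; congr EFin; ring.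
rewrite /entropy dA integralB//; [|exact: integrableZl|exact: integrableZl].
rewrite !integralZl// Ig Iq mule1 -EFinM -EFinB -EFinN; congr EFin.
by rewrite /A /B; field; rewrite gt_eqF.
Qed.

End gaussian_entropy.

(** * Le Cam's method *)

Section le_cam.
Context d (T : measurableType d) (R : realType).
Local Open Scope ereal_scope.

Lemma chi2_power (mu : {sigma_finite_measure set T -> \bar R}) n (l : T -> R)
    (C : R) :
  measurable_fun setT l -> \int[mu]_x (l x ^+ 2)%:E = C%:E ->
  \int[power_measure mu n]_t ((\prod_(i < n) l (tnth t i)) ^+ 2)%:E =
  (C ^+ n)%:E.
Proof.
move=> ml lC.
under eq_integral do rewrite -prodrXl.
rewrite (@integral_power_prod _ _ _ mu n (fun _ x => l x ^+ 2)%R (fun=> C))//.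
- by rewrite prodr_const card_ord.
- by move=> i; exact: measurable_funX.
- by move=> i x; exact: sqr_ge0.
Qed.

(** Whatever f is, |a - f| + |b - f| l dominates |a - b| min (1, l), and
    min (1, l) >= l - l^2 / 4 because (l / 2 - 1)^2 >= 0. Integrating against P0
    gives the bound; the term l^2 / 4 is moved to the other side beforehand so
    that only nonnegative functions are integrated. *)
Lemma le_cam_chi2 (P0 P1 : probability T R) (l f : T -> R) (C a b : R) :
  measurable_fun setT l -> (forall x, 0 <= l x)%R ->
  has_density P1 P0 l -> \int[P0]_x (l x ^+ 2)%:E = C%:E ->
  measurable_fun setT f ->
  (`|a - b| * (1 - C / 4))%:E <=
  \int[P0]_x `|a%:E - (f x)%:E| + \int[P1]_x `|b%:E - (f x)%:E|.
Proof.
move=> ml l0 dl lC mf; set D : R := `|a - b|%R.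
have D0 : (0 <= D)%R by exact: normr_ge0.
have mdist c : measurable_fun setT (fun x => `|c%:E - (f x)%:E|).
  apply: measurableT_comp => //; apply: emeasurable_funB => //.
  exact/measurable_EFinP.
have mEl : measurable_fun setT (fun x => (l x)%:E) by exact/measurable_EFinP.
have ml2 : measurable_fun setT (fun x => (l x ^+ 2)%:E).
  by apply/measurable_EFinP; exact: measurable_funX.
have ID : \int[P0]_x (D%:E * (l x)%:E) = D%:E.
  rewrite -dl// integral_cst// -[RHS]mule1; congr (_ * _).
  exact: probability_setT.
have pointwise x : D%:E * (l x)%:E <=
    (`|a%:E - (f x)%:E| + `|b%:E - (f x)%:E| * (l x)%:E) +
    (D / 4)%:E * (l x ^+ 2)%:E.
  rewrite -!EFinB !abse_EFin -!EFinM -!EFinD lee_fin.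
  have DAB : (D <= `|a - f x| + `|b - f x|)%R.
    rewrite /D (_ : a - b = (a - f x) - (b - f x))%R; last by ring.
    exact: ler_normB.
  have := normr_ge0 (a - f x)%R; have := normr_ge0 (b - f x)%R.
  move: (l0 x) DAB D0; move: (l x) => y y0; generalize D.
  move: `|a - f x|%R `|b - f x|%R => A B E EAB E0 B0 A0.
  have [y1|/ltW y1] := leP y 1%R.
    have h1 : (0 <= y * (A + B - E))%R by rewrite mulr_ge0// subr_ge0.
    have h2 : (0 <= A * (1 - y))%R by rewrite mulr_ge0// subr_ge0.
    have h3 : (0 <= E * y ^+ 2)%R by rewrite mulr_ge0// sqr_ge0.
    nra.
  have h1 : (0 <= B * (y - 1))%R by rewrite mulr_ge0// subr_ge0.
  have h2 : (0 <= E * (y / 2 - 1) ^+ 2)%R by rewrite mulr_ge0// sqr_ge0.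
  nra.
have : \int[P0]_x (D%:E * (l x)%:E) <=
    (\int[P0]_x `|a%:E - (f x)%:E| + \int[P1]_x `|b%:E - (f x)%:E|) +
    (D / 4 * C)%:E.
  rewrite dl// EFinM -lC -ge0_integralZl//; last 2 first.
  - by move=> x _; rewrite lee_fin sqr_ge0.
  - by rewrite lee_fin divr_ge0.
  rewrite -ge0_integralD//; last 2 first.
  - by move=> x _; rewrite mule_ge0// lee_fin.
  - exact: emeasurable_funM.
  rewrite -ge0_integralD//; last 4 first.
  - by move=> x _; rewrite adde_ge0// mule_ge0// lee_fin.
  - by apply: emeasurable_funD => //; exact: emeasurable_funM.
  - by move=> x _; rewrite mule_ge0// lee_fin ?sqr_ge0// divr_ge0.
  - exact: measurable_funeM.
  apply: ge0_le_integral => //.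
  - by move=> x _; rewrite mule_ge0// lee_fin.
  - exact: measurable_funeM.
  - apply: emeasurable_funD; last exact: measurable_funeM.
    by apply: emeasurable_funD => //; exact: emeasurable_funM.
rewrite ID -leeBlDr// -EFinB; apply: le_trans.
by rewrite lee_fin (_ : D * (1 - C / 4) = D - D / 4 * C)%R//; field.
Qed.

End le_cam.

Section two_point_minimax.
Context (R : realType) (d : nat).
Local Open Scope ereal_scope.

(** A supremum is at least the average of two of its members. *)
Lemma minimax_risk_two_points n (sigma delta : R)
    (F : set (probability (Rd R d) R)) P0 P1 :
  F P0 -> F P1 ->
  (forall hhat : estimator R d n,
    (2 * delta)%:E <= risk sigma hhat P0 + risk sigma hhat P1) ->
  delta%:E <= minimax_risk n sigma F.
Proof.
move=> F0 F1 lb; apply/ereal_infP => _ [hhat _ <-].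
set S := ereal_sup _.
have S0 : risk sigma hhat P0 <= S by apply: ereal_sup_ubound; exists P0.
have S1 : risk sigma hhat P1 <= S by apply: ereal_sup_ubound; exists P1.
have : (2 * delta)%:E <= S + S := le_trans (lb hhat) (leeD S0 S1).
case: S {S0 S1} => [x| |]//.
- by rewrite -EFinD !lee_fin => h; lra.
- by move=> _; rewrite leey.
Qed.

Lemma convolution_gaussian_density (s t : R) : (0 < s)%R -> (0 < t)%R ->
  has_density (convolution (gaussian d s) (gaussian d t)) (lebesgue_Rd R d)
    (gaussian_pdf (Num.sqrt (s ^+ 2 + t ^+ 2))).
Proof.
move=> s0 t0 f mf f0.
rewrite -gaussian_has_density// -gaussian_convolution//.
rewrite /convolution ge0_integral_distribution//.
rewrite fubini_tonelli1//; last by move=> z; exact: f0.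
exact: measurableT_comp mf (@measurable_addRd _ _).
Qed.

(** The constant M is the second moment of a standard normal law. *)
Lemma entropy_smoothed_gaussian : exists M : R, forall s t : R,
  (0 < s)%R -> (0 < t)%R ->
  entropy (convolution (gaussian d s) (gaussian d t)) =
  (d%:R * (M / 2 - ln (normal_peak (Num.sqrt (s ^+ 2 + t ^+ 2)))))%:E.
Proof.
have [M MP] := integral_sqr_normal R; exists M => s t s0 t0.
have r0 : (0 < Num.sqrt (s ^+ 2 + t ^+ 2))%R.
  by rewrite sqrtr_gt0 addr_gt0// exprn_gt0.
apply: (entropy_gaussian_density r0 (MP _ r0)).
exact: convolution_gaussian_density.
Qed.

End two_point_minimax.

(** * Two Gaussians with nearby variances *)

Section gaussian_family.
Context (R : realType).
Implicit Types (s t u v : R).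

Definition normal_ratio s0 s1 (x : R) : R :=
  normal_pdf 0 s1 x / normal_pdf 0 s0 x.

Lemma measurable_normal_ratio s0 s1 : 0 < s0 ->
  measurable_fun setT (normal_ratio s0 s1).
Proof.
move=> s00; apply: measurable_funM; first exact: measurable_normal_pdf.
apply: continuous_measurable_fun => x; apply: cvgV.
  by rewrite gt_eqF// normal_pdf_gt0.
by apply: continuous_normal_pdf; rewrite gt_eqF.
Qed.

Lemma normal_ratio_ge0 s0 s1 x : 0 <= normal_ratio s0 s1 x.
Proof. by rewrite divr_ge0// normal_pdf_ge0. Qed.

Lemma normal_ratio_has_density s0 s1 : 0 < s0 ->
  has_density (normal_prob 0 s1) (normal_prob 0 s0) (normal_ratio s0 s1).
Proof.
move=> s00 f mf f0; have mr := measurable_normal_ratio s1 s00.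
rewrite normal_has_density// normal_has_density; last 2 first.
- by apply: emeasurable_funM => //; exact/measurable_EFinP.
- by move=> x; rewrite mule_ge0// lee_fin normal_ratio_ge0.
apply: eq_integral => x _; rewrite -muleA -EFinM divfK// gt_eqF//.
exact: normal_pdf_gt0.
Qed.

Lemma normal_ratio_chi2 s0 s1 s2 : 0 < s0 -> 0 < s1 -> 0 < s2 ->
  (s2 ^+ 2)^-1 = 2 * (s1 ^+ 2)^-1 - (s0 ^+ 2)^-1 ->
  (\int[normal_prob 0 s0]_x (normal_ratio s0 s1 x ^+ 2)%:E =
   (s0 * s2 / s1 ^+ 2)%:E)%E.
Proof.
move=> s00 s10 s20 s2E; have mr := measurable_normal_ratio s1 s00.
rewrite normal_has_density; last 2 first.
- by apply/measurable_EFinP; exact: measurable_funX.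
- by move=> x; rewrite lee_fin sqr_ge0.
under eq_integral do rewrite -EFinM (normal_pdf_chi2 _ s00 s10 s20 s2E) EFinM.
rewrite ge0_integralZl.
- by rewrite integral_normal_pdf mule1.
- exact: measurableT.
- by apply/measurable_EFinP; exact: measurable_normal_pdf.
- by move=> x _; rewrite lee_fin normal_pdf_ge0.
- by rewrite lee_fin divr_ge0 ?exprn_ge0 ?mulr_ge0 ?ltW.
Qed.

(** Here C = 1 / sqrt (1 - u^2) >= 1, so C <= C^2 = 1 / (1 - u^2), a form that
    combines with Bernoulli's inequality after raising to the power d n. *)
Lemma normal_ratio_chi2_le v u : 0 < v -> 0 < u -> u < 1 ->
  exists C, [/\ (\int[normal_prob 0 (Num.sqrt v)]_x
      (normal_ratio (Num.sqrt v) (Num.sqrt (v * (1 + u))) x ^+ 2)%:E = C%:E)%E,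
    0 <= C & C * (1 - u ^+ 2) <= 1].
Proof.
move=> v0 u0 u1.
have v1 : 0 < v * (1 + u) by rewrite mulr_gt0// addr_gt0.
have v2 : 0 < v * (1 + u) / (1 - u) by rewrite divr_gt0// subr_gt0.
have sq (w : R) : 0 < w -> Num.sqrt w ^+ 2 = w by move=> /ltW; exact: sqr_sqrtr.
set s0 := Num.sqrt v; set s1 := Num.sqrt (v * (1 + u)).
set s2 := Num.sqrt (v * (1 + u) / (1 - u)).
have s00 : 0 < s0 by rewrite sqrtr_gt0.
have s10 : 0 < s1 by rewrite sqrtr_gt0.
have s20 : 0 < s2 by rewrite sqrtr_gt0.
have uN : 1 - u != 0 by rewrite gt_eqF// subr_gt0.
have uP : 1 + u != 0 by rewrite gt_eqF// addr_gt0.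
set C := s0 * s2 / s1 ^+ 2.
have C0 : 0 <= C by rewrite divr_ge0 ?exprn_ge0 ?mulr_ge0 ?ltW.
have C2 : C ^+ 2 * (1 - u ^+ 2) = 1.
  rewrite /C expr_div_n exprMn !sq//.
  by field; rewrite uN uP gt_eqF.
exists C; split=> //.
- apply: normal_ratio_chi2 => //; rewrite !sq//.
  by field; rewrite uN uP gt_eqF.
- rewrite -[leRHS]C2; apply: ler_wpM2r.
    by rewrite subr_ge0 expr_le1 ?ltW.
  have [C1|C1] := leP 1 C; first by rewrite expr2 ler_peMl.
  exfalso; suff : C ^+ 2 * (1 - u ^+ 2) < 1 by rewrite C2 ltxx.
  apply: (@le_lt_trans _ _ (C ^+ 2)).
    by rewrite ler_piMr ?sqr_ge0// lerBlDr lerDl sqr_ge0.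
  by rewrite expr_lt1// ltW.
Qed.

Lemma bernoulli_inequality (x : R) m :
  0 <= x <= 1 -> 1 - m%:R * x <= (1 - x) ^+ m.
Proof.
move=> /andP[x0 x1]; elim: m => [|m IHm]; first by rewrite mul0r subr0 expr0.
rewrite exprSr; apply: le_trans (ler_wpM2r _ IHm); last by rewrite subr_ge0.
rewrite -natr1 -subr_ge0.
rewrite (_ : _ - _ = m%:R * x ^+ 2); first by rewrite mulr_ge0// sqr_ge0.
by ring.
Qed.

Lemma ln_normal_peak s : 0 < s ->
  ln (normal_peak s) = - (ln (s ^+ 2) / 2) - ln (Num.sqrt (pi *+ 2)).
Proof.
move=> s0; have p0 := sqrt_2pi_gt0 R.
rewrite normal_peakE// lnM ?posrE ?invr_gt0// !lnV ?posrE// lnXn//.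
by congr (- _ - _); field.
Qed.

(** With X and Y the two variances after smoothing, the gap is ln (Y / X) / 2.
    It is bounded below by (1 - X / Y) / 2, and Y <= 2 X since u < 1. *)
Lemma ln_normal_peak_gap s v u : 0 < s -> 0 < v -> 0 < u -> u < 1 ->
  v / (s ^+ 2 + v) * u / 4 <=
  ln (normal_peak (Num.sqrt (v + s ^+ 2))) -
  ln (normal_peak (Num.sqrt (v * (1 + u) + s ^+ 2))).
Proof.
move=> s0 v0 u0 u1; have s20 : 0 < s ^+ 2 by rewrite exprn_gt0.
have X0 : 0 < v + s ^+ 2 by rewrite addr_gt0.
have Y0 : 0 < v * (1 + u) + s ^+ 2 by rewrite addr_gt0// mulr_gt0// addr_gt0.
rewrite !ln_normal_peak ?sqrtr_gt0// !sqr_sqrtr; [|exact: ltW..].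
move: (s ^+ 2) s20 X0 Y0 => w w0 X0 Y0.
set X := v + w; set Y := v * (1 + u) + w.
have lnXY : ln (X / Y) <= X / Y - 1.
  rewrite -[X in ln X <= _](subrKC 1); apply: le_ln1Dx.
  by rewrite ltrBrDr addNr divr_gt0.
rewrite ln_div ?posrE// in lnXY.
have XY : v / X * u / 2 <= 1 - X / Y.
  have -> : 1 - X / Y = v * u / Y by rewrite /X /Y; field; rewrite gt_eqF.
  have -> : v / X * u / 2 = v * u / (X * 2) by field; rewrite gt_eqF.
  rewrite ler_pM2l ?mulr_gt0// lef_pV2 ?posrE ?mulr_gt0//.
  have : v * u <= v by rewrite ler_piMr ?ltW.
  by rewrite /X /Y; lra.
by rewrite (addrC w v) -/X; lra.
Qed.

Local Open Scope ereal_scope.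

(** The likelihood ratio of the n samples is a product of d n one-dimensional
    ratios, whose chi-square integral is at most (1 - u^2)^-(d n) <= 2. *)
Lemma le_cam_gaussian d n v u (f : n.-tuple (Rd R d) -> R) (a b : R) :
  (0 < v)%R -> (0 < u)%R -> (u < 1)%R -> ((d * n)%:R * u ^+ 2 <= 2^-1)%R ->
  measurable_fun setT f ->
  (`|a - b| / 2)%:E <=
  \int[power_measure (gaussian d (Num.sqrt v)) n]_x `|a%:E - (f x)%:E| +
  \int[power_measure (gaussian d (Num.sqrt (v * (1 + u)))) n]_x
    `|b%:E - (f x)%:E|.
Proof.
move=> v0 u0 u1 dnu mf; set s0 := Num.sqrt v; set s1 := Num.sqrt _.
have s00 : (0 < s0)%R by rewrite sqrtr_gt0.
have [C [chi2C C0 C1]] := normal_ratio_chi2_le v0 u0 u1.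
have u2_1 : (0 <= u ^+ 2 <= 1)%R by rewrite sqr_ge0/= expr_le1// ltW.
have ml := measurable_normal_ratio s1 s00.
have l0 := normal_ratio_ge0 s0 s1.
pose ld (x : Rd R d) := (\prod_(i < d) normal_ratio s0 s1 (tnth x i))%R.
have mld : measurable_fun setT ld.
  exact: (measurable_prod_coord (g := fun=> normal_ratio s0 s1)).
have ld0 (x : Rd R d) : (0 <= ld x)%R by exact: prodr_ge0.
have dd : has_density (gaussian d s1) (gaussian d s0) ld.
  apply: (@has_density_power _ (measurableTypeR R)) ml l0 _.
  exact: normal_ratio_has_density.
have chi2d : \int[gaussian d s0]_x (ld x ^+ 2)%:E = (C ^+ d)%:E.
  exact: (@chi2_power _ (measurableTypeR R) R (normal_prob 0 s0) d _ C ml chi2C).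
have ddn : has_density (power_measure (gaussian d s1) n)
    (power_measure (gaussian d s0) n) (fun x => \prod_(i < n) ld (tnth x i))%R.
  exact: has_density_power.
have chi2n : \int[power_measure (gaussian d s0) n]_x
    ((\prod_(i < n) ld (tnth x i)) ^+ 2)%:E = ((C ^+ d) ^+ n)%:E.
  exact: chi2_power.
have mldn : measurable_fun setT (fun x : n.-tuple (Rd R d) =>
    \prod_(i < n) ld (tnth x i))%R.
  exact: (measurable_prod_coord (g := fun=> ld)).
have ldn0 (x : n.-tuple (Rd R d)) : (0 <= \prod_(i < n) ld (tnth x i))%R.
  exact: prodr_ge0.
have lecam := @le_cam_chi2 _ _ R (power_measure (gaussian d s0) n)
  (power_measure (gaussian d s1) n) _ f _ a b mldn ldn0 ddn chi2n mf.
apply: le_trans lecam; rewrite lee_fin ler_wpM2l//.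
suff : ((C ^+ d) ^+ n <= 2)%R by lra.
rewrite -exprM.
have half : (2^-1 <= (1 - u ^+ 2) ^+ (d * n))%R.
  by apply: le_trans (bernoulli_inequality (d * n) u2_1); lra.
have CB : (C ^+ (d * n) * (1 - u ^+ 2) ^+ (d * n) <= 1)%R.
  by rewrite -exprMn exprn_ile1// mulr_ge0// subr_ge0; case/andP: u2_1.
have : (C ^+ (d * n) * 2^-1 <= 1)%R.
  by apply: le_trans CB; rewrite ler_wpM2l// exprn_ge0.
lra.
Qed.

End gaussian_family.

Theorem proposition8 (R : realType) (sigma K : R) (d : nat) :
  0 < sigma -> 0 < K -> (1 <= d)%N ->
  exists c : R, 0 < c /\
    \forall n \near \oo,
      ((c / Num.sqrt n%:R)%:E <=
       minimax_risk n sigma (@subgaussian R d K))%E.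
Proof.
move=> sigma0 K0 d1; have [M entropyE] := entropy_smoothed_gaussian R d.
pose v : R := K ^+ 2 / 2.
have v0 : 0 < v by rewrite divr_gt0// exprn_gt0.
have dR0 : 0 < d%:R :> R by rewrite ltr0n.
pose rho : R := v / (sigma ^+ 2 + v).
have rho0 : 0 < rho by rewrite divr_gt0// addr_gt0// exprn_gt0.
have q0 : 0 < Num.sqrt (2 * d%:R) :> R by rewrite sqrtr_gt0 mulr_gt0.
(* c / sqrt n is d * rho * u / 16 for the u chosen below *)
exists (d%:R * rho / (16 * Num.sqrt (2 * d%:R))); split.
  by apply: divr_gt0; exact: mulr_gt0.
exists 1%N => // n /= n1.
have nR0 : 0 < n%:R :> R by rewrite ltr0n.
(* the largest u for which Bernoulli's inequality still yields 1/2 *)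
pose u : R := (Num.sqrt (2 * d%:R) * Num.sqrt n%:R)^-1.
have u0 : 0 < u by rewrite invr_gt0 mulr_gt0// sqrtr_gt0.
have u2 : (d * n)%:R * u ^+ 2 = 2^-1.
  rewrite exprVn exprMn !sqr_sqrtr ?mulr_ge0 ?ler0n// natrM.
  by field; rewrite !gt_eqF.
have u2_le : u ^+ 2 <= 2^-1.
  by rewrite -u2 ler_peMl ?sqr_ge0// ler1n muln_gt0 d1.
have u1 : u < 1.
  by rewrite -(@expr_lt1 _ 2)// ?ltW//; apply: le_lt_trans u2_le _; lra.
have v10 : 0 < v * (1 + u) by rewrite mulr_gt0// addr_gt0.
pose s0 := Num.sqrt v; pose s1 := Num.sqrt (v * (1 + u)).
have s00 : 0 < s0 by rewrite sqrtr_gt0.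
have s10 : 0 < s1 by rewrite sqrtr_gt0.
have leK w : w <= K ^+ 2 -> Num.sqrt w <= K.
  by move=> wK; rewrite -[leRHS](gtr0_norm K0) -sqrtr_sqr ler_wsqrtr.
have KE : K ^+ 2 = v + v by rewrite /v; field.
have vu : v * u <= v by rewrite ler_piMr ?ltW.
have sub0 : subgaussian K (gaussian d s0).
  by apply: gaussian_subgaussian => //; apply: leK; rewrite KE; lra.
have sub1 : subgaussian K (gaussian d s1).
  by apply: gaussian_subgaussian => //; apply: leK; rewrite KE; lra.
apply: (minimax_risk_two_points sub0 sub1) => hhat.
rewrite /risk !entropyE// !sqr_sqrtr; [|exact: ltW..].
have dnu : (d * n)%:R * u ^+ 2 <= 2^-1 by rewrite u2.
apply: le_trans (le_cam_gaussian _ _ v0 u0 u1 dnu (measurable_funP hhat)).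
rewrite lee_fin; have gap := ln_normal_peak_gap sigma0 v0 u0 u1.
rewrite -/rho in gap.
have -> : 2 * (d%:R * rho / (16 * Num.sqrt (2 * d%:R)) / Num.sqrt n%:R) =
    d%:R * (rho * u / 4) / 2.
  by rewrite /u; field; rewrite !gt_eqF// sqrtr_gt0.
rewrite ler_pM2r// distrC; apply: le_trans (ler_norm _).
by rewrite -mulrBr ler_pM2l//; lra.
Qed.
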